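(* There is a Hadamard simplex $\Delta$ in dimension $d=11$ such that, for all positive odd integers $m,n$ with $n<m<7n/3$ and $m-n\equiv 2\pmod 4$, the polytope $P_{m,n}=m\Delta\cap[-n,n]^{11}$ is nonintegral, i.e. it has a vertex that does not lie in $\Lambda_n=(n+2\mathbb Z)^{11}$. In particular, for this simplex, $P_{5,3}$ is nonintegral.
   Context: Hadamard simplices: let $H$ be a real Hadamard matrix of order $N$ (an $N\times N$ matrix with entries $\pm1$ and $HH^{\mathsf T}=NI$). Mark one column of $H$, multiply rows by signs so that this column becomes all ones, and delete it. With $d=N-1$, the remaining rows $v_0,\dots,v_{N-1}\in\{\pm1\}^d$ satisfy $v_i\cdot v_j=N\delta_{ij}-1$ and $\sum_i v_i=0$. The Hadamard simplex is $\Delta=\operatorname{conv}\{v_0,\dots,v_{N-1}\}\subset\mathbb R^d$; equivalently $\Delta=\{x: v_i\cdot x\ge -1\ \forall i\}$. For positive odd integers $n<m<dn$, $P_{m,n}=m\Delta\cap[-n,n]^d$ and $\Lambda_n=(n+2\mathbb Z)^d$. $P_{m,n}$ is integral (a lattice polytope) if all its vertices lie in $\Lambda_n$, and nonintegral otherwise. *)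

(* Defs.v *)
From mathcomp Require Import all_boot all_order all_algebra.
From mathcomp Require Import classical_sets reals.

Set Implicit Arguments.
Unset Strict Implicit.
Unset Printing Implicit Defensive.

Import Order.TTheory GRing.Theory Num.Theory.

Local Open Scope classical_set_scope.
Local Open Scope ring_scope.

Definition is_hadamard (R : realType) (N : nat) (H : 'M[R]_N) : Prop :=
  (forall i j, H i j = 1 \/ H i j = -1) /\ H *m H^T = N%:R%:M.

(* Since H i j is +1 or -1, multiplying row i by H i j is the unique row sign
   change that makes the marked column j all ones. *)
Definition normalize_col (R : realType) (N : nat) (H : 'M[R]_N) (j : 'I_N) :
    'M[R]_N :=
  \matrix_(i, k) (H i j * H i k).

Definition hadamard_vector (R : realType) (d : nat) (H : 'M[R]_d.+1)
    (j : 'I_d.+1) (i : 'I_d.+1) : 'rV[R]_d :=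
  row i (col' j (normalize_col H j)).

Definition conv_hull (R : realType) (d k : nat) (v : 'I_k -> 'rV[R]_d) :
    set 'rV[R]_d :=
  [set x | exists w : 'I_k -> R,
     [/\ forall i, 0 <= w i, \sum_i w i = 1 & x = \sum_i w i *: v i]].

Definition is_hadamard_simplex (R : realType) (d : nat)
    (Delta : set 'rV[R]_d) : Prop :=
  exists (H : 'M[R]_d.+1) (j : 'I_d.+1),
    is_hadamard H /\ Delta = conv_hull (hadamard_vector H j).

Definition cube (R : realType) (d n : nat) : set 'rV[R]_d :=
  [set x | forall i, - n%:R <= x 0 i <= n%:R].

Definition truncated_simplex (R : realType) (d : nat) (Delta : set 'rV[R]_d)
    (m n : nat) : set 'rV[R]_d :=
  [set m%:R *: y | y in Delta] `&` cube n.

(* A vertex is a zero-dimensional face: a point of P that is the unique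
   maximizer over P of some linear functional, given by its coefficients c. *)
Definition is_vertex (R : realType) (d : nat) (P : set 'rV[R]_d)
    (x : 'rV[R]_d) : Prop :=
  P x /\ exists c : 'rV[R]_d, forall y, P y -> y <> x ->
    \sum_i c 0 i * y 0 i < \sum_i c 0 i * x 0 i.

Definition lattice (R : realType) (d n : nat) : set 'rV[R]_d :=
  [set x | forall i, exists z : int, x 0 i = n%:R + 2 * z%:~R].

Definition nonintegral (R : realType) (d : nat) (P : set 'rV[R]_d)
    (n : nat) : Prop :=
  exists x : 'rV[R]_d, is_vertex P x /\ ~ lattice n x.

(* Main.v *)
Require Import Defs.
From mathcomp Require Import all_boot all_order all_algebra.
From mathcomp Require Import classical_sets reals.
From mathcomp Require Import zify ring lra.

Set Implicit Arguments.
Unset Strict Implicit.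
Unset Printing Implicit Defensive.

Import Order.TTheory GRing.Theory Num.Theory.

Local Open Scope ring_scope.

(** The simplex comes from the Paley matrix of order 12
      H = [[S + 1, S - 1], [S - 1, - (S + 1)]],
    where S is the symmetric conference matrix of order 6 built from the
    quadratic residues mod 5, so that S^2 = 5.  The marked column is the first
    one of the right half.

    Membership in m Delta becomes transparent after inserting the constant m at
    the marked position of y: the six-plus-six vector (l, r) so obtained
    satisfies v_i . y + m = H_ij (H (l, r))_i, and y lies in m Delta exactly
    when all these slacks are nonnegative ([dilated_simplexP]), because they
    are, up to the factor 12 m, the barycentric coordinates of y / m.

    Now put the five unmarked coordinates of the right half on the cube facets
    x_k = n and make the first six simplex inequalities tight.  With
    r = (m, n, n, n, n, n) this reads (S + 1) l + (S - 1) r = 0.  Multiplying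
    by S - 1 and using S^2 = 5 gives 4 l = - (S - 1)^2 r = 2 (S - 3) r, hence
      l = ((5 n - 3 m) / 2, (m - 3 n) / 2, ..., (m - 3 n) / 2).
    The solution is unique because (S - 1) (S + 1) = 4, so these eleven tight
    constraints cut out a vertex as soon as the point is feasible, which
    happens for n <= m <= 7 n / 3 ([paley_vertexP]).  Its first coordinate is
    n - 3 (m - n) / 2, which differs from n by an odd integer when
    m - n = 2 mod 4; hence the vertex is not a lattice point. *)

(** * Vertices from tight constraints *)

(** A point where finitely many functionals simultaneously attain their maximum
    over P is exposed by their sum: another maximizer of the sum would maximize
    each of them, and jointly they separate points. *)
Lemma vertex_of_tight (R : realType) (d : nat) (P : set 'rV[R]_d)
    (I : finType) (f : I -> 'rV[R]_d) (x : 'rV[R]_d) :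
  P x ->
  (forall t y, P y -> \sum_k f t 0 k * y 0 k <= \sum_k f t 0 k * x 0 k) ->
  (forall u : 'rV[R]_d, (forall t, \sum_k f t 0 k * u 0 k = 0) -> u = 0) ->
  is_vertex P x.
Proof.
move=> Px fle finj; split=> //; exists (\sum_t f t) => y Py yx.
have sumE (z : 'rV[R]_d) : \sum_k (\sum_t f t) 0 k * z 0 k =
    \sum_t \sum_k f t 0 k * z 0 k.
  rewrite exchange_big; apply: eq_bigr => k _.
  by rewrite summxE mulr_suml.
rewrite !sumE lt_neqAle ler_sum ?andbT; last by move=> t _; apply: fle.
apply/eqP => eq_sum; apply/yx/subr0_eq/finj => t.
have /eqP : \sum_t (\sum_k f t 0 k * x 0 k - \sum_k f t 0 k * y 0 k) = 0.
  by rewrite sumrB eq_sum subrr.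
rewrite psumr_eq0 => [/allP/(_ t)|s _]; last by rewrite subr_ge0 fle.
rewrite mem_index_enum => /(_ isT) /= /eqP/subr0_eq fE.
under eq_bigr do rewrite !mxE mulrBr.
by rewrite sumrB fE subrr.
Qed.

(** * Facets of a dilated Hadamard simplex *)

Definition homogenize (R : realType) (d : nat) (j : 'I_d.+1) (t : R)
    (y : 'rV[R]_d) : 'cV[R]_d.+1 :=
  \col_k (if unlift j k is Some l then y 0 l else t).

Section HadamardSimplex.
Variables (R : realType) (d : nat) (H : 'M[R]_d.+1) (j : 'I_d.+1).
Hypothesis hadH : is_hadamard H.

(** The simplex inequality v_i . y >= - t, written with the whole matrix H
    instead of the matrix with its marked column removed; see [slackE]. *)
Definition slack (t : R) (y : 'rV[R]_d) (i : 'I_d.+1) : R :=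
  H i j * (H *m homogenize j t y) i 0.

Lemma hadamard_sign_sqr i k : H i k * H i k = 1.
Proof. by have [sgn _] := hadH; case: (sgn i k) => ->; rewrite ?mulrNN mulr1. Qed.

Lemma hadamard_trmul : H^T *m H = d.+1%:R%:M.
Proof.
have [_ HHT] := hadH; have N0 : d.+1%:R != 0 :> R by rewrite pnatr_eq0.
have : (d.+1%:R^-1 *: H) *m H^T = 1%:M.
  by rewrite -scalemxAl HHT scale_scalar_mx mulVf.
move/mulmx1C; rewrite -scalemxAr => /(congr1 ( *:%R d.+1%:R)).
by rewrite scalerA divff // scale1r scale_scalar_mx mulr1.
Qed.

Lemma slackE t y i :
  slack t y i = t + \sum_k hadamard_vector H j i 0 k * y 0 k.
Proof.
rewrite /slack mxE (bigD1_ord j) //= !mxE unlift_none mulrDr mulrA.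
rewrite hadamard_sign_sqr mul1r mulr_sumr; congr (_ + _).
by apply: eq_bigr => k _; rewrite !mxE liftK mulrA.
Qed.

(** The marked column of a normalized Hadamard matrix is constant, so the
    condition that the weights sum to 1 is just one more coordinate of the
    equation expressing y as a combination of the v_i. *)
Lemma homogenize_comb (m : R) (w : 'I_d.+1 -> R) (y : 'rV[R]_d) : m != 0 ->
  (\sum_i w i = 1 /\ m *: (\sum_i w i *: hadamard_vector H j i) = y) <->
  H^T *m \col_i (m * w i * H i j) = homogenize j m y.
Proof.
move=> m0; have jE : (H^T *m \col_i (m * w i * H i j)) j 0 = m * \sum_i w i.
  rewrite mxE mulr_sumr; apply: eq_bigr => i _.
  by rewrite !mxE mulrC -(mulrA (m * w i)) hadamard_sign_sqr mulr1.
have kE k : (H^T *m \col_i (m * w i * H i j)) (lift j k) 0 =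
    (m *: (\sum_i w i *: hadamard_vector H j i)) 0 k.
  rewrite !mxE summxE mulr_sumr; apply: eq_bigr => i _; rewrite !mxE.
  by rewrite mulrC !mulrA.
split=> [[w1 yE]|E].
  apply/matrixP => k z; rewrite ord1 [RHS]mxE.
  by case: unliftP => [l|] ->; rewrite ?kE ?yE // jE w1 mulr1.
split; last by apply/rowP => k; rewrite -kE E mxE liftK.
by apply: (mulfI m0); rewrite -jE E mxE unlift_none mulr1.
Qed.

(** The system of [homogenize_comb] for the weights is square, with matrix
    inverted by H / d.+1; its solution is the slack vector up to a positive
    factor, so y / m is a convex combination iff the slacks are nonnegative. *)
Lemma dilated_simplexP (m : R) (y : 'rV[R]_d) : 0 < m ->
  [set m *: z | z in conv_hull (hadamard_vector H j)]%classic y <->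
  forall i, 0 <= slack m y i.
Proof.
move=> m_gt0; have m0 := lt0r_neq0 m_gt0.
have N_gt0 : 0 < d.+1%:R :> R by rewrite ltr0n.
have N0 := lt0r_neq0 N_gt0.
split=> [[z [w [w_ge0 w1 ->]] yE] i | sl_ge0].
  have /homogenize_comb : \sum_i w i = 1 /\
    m *: (\sum_i w i *: hadamard_vector H j i) = y by [].
  rewrite /slack => <- //; have [_ HHT] := hadH.
  rewrite mulmxA HHT mul_scalar_mx !mxE.
  have -> : H i j * (d.+1%:R * (m * w i * H i j)) =
      d.+1%:R * (m * w i) * (H i j * H i j) by ring.
  by rewrite hadamard_sign_sqr mulr1 !mulr_ge0 // ltW.
pose w i := slack m y i / (m * d.+1%:R).
have [w1 yE] : \sum_i w i = 1 /\
    m *: (\sum_i w i *: hadamard_vector H j i) = y.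
  apply/homogenize_comb => //.
  have -> : \col_i (m * w i * H i j) =
      d.+1%:R^-1 *: (H *m homogenize j m y).
    apply/matrixP => i z; rewrite ord1 [LHS]mxE [RHS]mxE /w /slack.
    set g := (_ *m _) _ _; transitivity (H i j * H i j * g / d.+1%:R).
      by field; rewrite nat1r N0.
    by rewrite hadamard_sign_sqr mul1r mulrC.
  rewrite -scalemxAr mulmxA hadamard_trmul mul_scalar_mx scalerA mulVf //.
  by rewrite scale1r.
exists (\sum_i w i *: hadamard_vector H j i) => //.
by exists w; split=> // i; rewrite divr_ge0 // mulr_ge0 // ltW.
Qed.

End HadamardSimplex.

(** * The Paley matrix of order 12 *)

Definition quadratic_char5 (R : realType) (k : nat) : R :=
  nth 0 [:: 0; 1; -1; -1; 1] (k %% 5).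

(** The core is the matrix of the quadratic character of i - k mod 5; the
    summand 4 * k stands for - k, avoiding truncated subtraction. *)
Definition conference6 (R : realType) : 'M[R]_(1 + 5) :=
  block_mx 0 (const_mx 1) (const_mx 1)
    (\matrix_(i, k) quadratic_char5 R (i + 4 * k)).

Definition paley12 (R : realType) : 'M[R]_((1 + 5) + (1 + 5)) :=
  block_mx (conference6 R + 1%:M) (conference6 R - 1%:M)
           (conference6 R - 1%:M) (- (conference6 R + 1%:M)).

Lemma conference6_tr (R : realType) : (conference6 R)^T = conference6 R.
Proof.
rewrite /conference6 tr_block_mx trmx0 !trmx_const; congr block_mx.
apply/matrixP => i k; rewrite !mxE.
by move: i k; do 2!case=> [[|[|[|[|[|//]]]]] ?].
Qed.

Lemma conference6_entry (R : realType) i k :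
  let S := conference6 R in
  S i k = 0 /\ i = k \/ (S i k = 1 \/ S i k = -1) /\ i != k.
Proof.
move=> S; case: (split_ordP i) => i' ->; case: (split_ordP k) => k' ->.
- by left; rewrite !ord1 block_mxEul mxE.
- by right; rewrite block_mxEur mxE eq_lrshift; split; [left | ].
- by right; rewrite block_mxEdl mxE eq_rlshift; split; [left | ].
rewrite block_mxEdr mxE eq_rshift.
by move: i' k'; do 2!case=> [[|[|[|[|[|//]]]]] ?];
  first [ by right; split; [left | ] | by right; split; [right | ]
        | by left; split=> //; apply: val_inj ].
Qed.

Lemma conference6_sqr (R : realType) : conference6 R *m conference6 R = 5%:M.
Proof.
rewrite mulmx_block -[RHS](@submxK _ 1 5 1 5).
by congr block_mx; apply/matrixP; do 2!case=> [[|[|[|[|[|//]]]]] ?] //;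
  rewrite !(mxE, big_ord_recl, big_ord0) /= /quadratic_char5 /=; ring.
Qed.

(** The rows of the core sum to 0, so vectors that are constant on the last five
    coordinates are stable under S. *)
Lemma conference6_mul_const (R : realType) (a b : R) :
  conference6 R *m col_mx a%:M (const_mx b) =
  col_mx (5 * b)%:M (const_mx a) :> 'cV_(1 + 5).
Proof.
rewrite mul_block_col; congr col_mx; apply/matrixP;
  case=> [[|[|[|[|[|//]]]]] ?] // i; rewrite (ord1 i);
  by rewrite !(mxE, big_ord_recl, big_ord0) /= /quadratic_char5 /=; ring.
Qed.

(** Since S is symmetric, H H^T has diagonal blocks
    (S + 1)^2 + (S - 1)^2 = 2 S^2 + 2 = 12 and off-diagonal blocks that vanish
    because S + 1 and S - 1 commute. *)
Lemma paley12_hadamard (R : realType) : is_hadamard (paley12 R : 'M_12).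
Proof.
have sgn (i k : 'I_((1 + 5) + (1 + 5))) :
    paley12 R i k = 1 \/ paley12 R i k = -1.
  case: (split_ordP i) => i' ->; case: (split_ordP k) => k' ->;
    rewrite /paley12 ?(block_mxEul, block_mxEur, block_mxEdl, block_mxEdr);
    move: (conference6_entry R i' k'); move: (conference6 R) => T;
    rewrite !mxE => -[[-> ->]|[+ /negPf->]]; rewrite ?eqxx /= ?mulr0n ?mulr1n;
    rewrite ?add0r ?addr0 ?subr0;
    first [by auto | by case=> ->; rewrite ?opprK; auto].
suff HHT : paley12 R *m (paley12 R)^T = 12%:R%:M.
  by split; [exact: sgn | exact: HHT].
rewrite /paley12 tr_block_mx mulmx_block.
rewrite [RHS](@scalar_mx_block _ (1 + 5) (1 + 5)).
rewrite linearN /= linearB linearD /= conference6_tr tr_scalar_mx.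
rewrite !(mulmxDl, mulmxDr, mulmxBl, mulmxBr, mulmxN, mulNmx, mul1mx, mulmx1).
rewrite !conference6_sqr; move: (conference6 R) => T.
by congr block_mx; apply/matrixP => i k; rewrite !mxE;
  case: (i == k); rewrite ?mulr1n ?mulr0n; ring.
Qed.

(** * The vertex *)

Local Notation mark := (rshift 6 (lshift 5 (ord0 : 'I_1)) : 'I_12).

Lemma homogenize_row_mx (R : realType) (t : R) (l : 'rV_(1 + 5)) (r : 'rV_5) :
  homogenize mark t (row_mx l r : 'rV_((1 + 5) + 5)) =
  col_mx l^T (col_mx t%:M r^T : 'cV_(1 + 5)) :> 'cV_((1 + 5) + (1 + 5)).
Proof.
apply/colP => k; rewrite mxE; case: unliftP => [q|] -> //.
  case: (@split_ordP 6 5 q) => i ->.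
    rewrite (_ : lift _ _ = lshift 6 i).
      rewrite col_mxEu [RHS]mxE; exact: row_mxEl.
    by apply: val_inj; rewrite /= /bump leqNgt ltn_ord.
  rewrite (_ : lift _ _ = rshift 6 (rshift 1 i)).
    rewrite col_mxEd; transitivity (r^T i 0); last exact/esym/col_mxEd.
    rewrite [RHS]mxE; exact: row_mxEr.
  exact: val_inj.
rewrite col_mxEd; apply/esym.
by etransitivity; [exact: col_mxEu | rewrite mxE].
Qed.

Lemma paley12_mul_const (R : realType) (a b t c : R) :
  paley12 R *m col_mx (col_mx a%:M (const_mx b) : 'cV_(1 + 5))
                      (col_mx t%:M (const_mx c) : 'cV_(1 + 5)) =
  col_mx
    (col_mx (a + 5 * b + 5 * c - t)%:M (const_mx (a + b + t - c)) : 'cV_(1 + 5))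
    (col_mx (5 * b - a - 5 * c - t)%:M
            (const_mx (a - b - t - c)) : 'cV_(1 + 5)).
Proof.
rewrite mul_block_col !(mulmxDl, mulmxBl, mulNmx, mul1mx) !conference6_mul_const.
by rewrite !(opp_col_mx, add_col_mx); congr (col_mx (col_mx _ _) (col_mx _ _));
  apply/matrixP => i k; rewrite ?ord1 !mxE ?eqxx ?mulr1n; ring.
Qed.

(** The left half is (S - 3) r / 2 for the right half r = (m, n, n, n, n, n)
    with the marked entry m restored: the solution of
    (S + 1) l + (S - 1) r = 0. *)
Definition paley_vertex (R : realType) (m n : R) : 'rV[R]_((1 + 5) + 5) :=
  row_mx (row_mx ((5 * n - 3 * m) / 2)%:M (const_mx ((m - 3 * n) / 2)))
         (const_mx n).

Lemma mul_homogenize_vertex (R : realType) (m n : R) :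
  (paley12 R : 'M_12) *m homogenize mark m (paley_vertex m n) =
  col_mx 0 (col_mx (3 * (m - 5 * n))%:M (const_mx (3 * (n - m))) : 'cV_(1 + 5))
  :> 'cV_((1 + 5) + (1 + 5)).
Proof.
rewrite homogenize_row_mx tr_row_mx tr_scalar_mx !trmx_const.
etransitivity; first exact: paley12_mul_const.
by congr col_mx; [rewrite -[RHS](@vsubmxK _ 1 5)|]; congr col_mx;
  apply/matrixP => i k; rewrite ?ord1 !mxE ?eqxx ?mulr1n; field.
Qed.

Lemma paley12_bottom_mark (R : realType) (i : 'I_6) :
  (paley12 R : 'M_12) (rshift 6 i) mark = -1.
Proof.
etransitivity.
  exact: (block_mxEdr _ _ _ _ (i : 'I_(1 + 5)) (lshift 5 ord0 : 'I_(1 + 5))).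
case: (@split_ordP 1 5 i) => k ->; rewrite 2!mxE [1%:M _ _]mxE.
  by rewrite block_mxEul mxE ord1 eqxx add0r.
by rewrite block_mxEdl mxE eq_rlshift addr0.
Qed.

Lemma slack_vertex_top (R : realType) (m n : R) (i : 'I_6) :
  slack (paley12 R : 'M_12) mark m (paley_vertex m n) (lshift 6 i) = 0.
Proof.
rewrite /slack mul_homogenize_vertex.
rewrite [X in _ * X](_ : _ = 0) ?mulr0 //.
by etransitivity; [exact: col_mxEu | rewrite mxE].
Qed.

Lemma slack_vertex_bottom (R : realType) (m n : R) (i : 'I_6) :
  n <= m <= 5 * n ->
  0 <= slack (paley12 R : 'M_12) mark m (paley_vertex m n) (rshift 6 i).
Proof.
move=> /andP[nm m5n].
rewrite /slack mul_homogenize_vertex paley12_bottom_mark mulN1r oppr_ge0.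
rewrite [leLHS](col_mxEd _ _ _ _).
case: (@split_ordP 1 5 i) => k ->.
  by rewrite [leLHS](col_mxEu _ _ _ _) mxE ord1 eqxx mulr1n; lra.
by rewrite [leLHS](col_mxEd _ _ _ _) mxE; lra.
Qed.

(** The six simplex constraints are independent on the six free coordinates,
    as (S - 1) (S + 1) = 4. *)
Lemma slack_top_inj (R : realType) (l : 'rV[R]_(1 + 5)) :
  (forall i : 'I_6, slack (paley12 R : 'M_12) mark 0
     (row_mx l 0 : 'rV_((1 + 5) + 5)) (lshift 6 i) = 0) ->
  l = 0.
Proof.
move=> sl0.
suff Sl : (conference6 R + 1%:M) *m l^T = 0.
  have : (conference6 R - 1%:M) *m ((conference6 R + 1%:M) *m l^T) =
      4%:R *: l^T.
    rewrite mulmxA -mul_scalar_mx; congr (_ *m _).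
    rewrite mulmxBl mul1mx mulmxDr mulmx1 conference6_sqr.
    by move: (conference6 R) => T; apply/matrixP => i k; rewrite !mxE;
      case: (i == k); rewrite ?mulr1n ?mulr0n; ring.
  rewrite Sl mulmx0 => /esym/eqP; rewrite scaler_eq0 pnatr_eq0 /=.
  by move/eqP/(congr1 trmx); rewrite trmxK trmx0.
have mulE : paley12 R *m col_mx l^T (col_mx 0%:M 0^T : 'cV_(1 + 5)) =
    col_mx ((conference6 R + 1%:M) *m l^T) ((conference6 R - 1%:M) *m l^T).
  rewrite trmx0 (raddf0 (@scalar_mx R 1)) col_mx0.
  by rewrite mul_block_col !mulmx0 !addr0.
apply/colP => i; rewrite [RHS]mxE.
have := sl0 i; rewrite /slack homogenize_row_mx mulE => /eqP; rewrite mulf_eq0.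
(* The sign in the slack is nonzero, its square being 1. *)
rewrite -[X in X || _]sqrf_eq0 expr2 (hadamard_sign_sqr (paley12_hadamard R)).
rewrite oner_eq0 /= => /eqP <-.
exact/esym/col_mxEu.
Qed.

(** The bound 7 n / 3 is where the first coordinate n - 3 (m - n) / 2 reaches
    the opposite cube facet x_0 = - n; the other inequalities hold with room to
    spare up to m = 5 n. *)
Lemma paley_vertexP (R : realType) (m n : nat) :
  (n < m)%N -> 3 * m%:R <= 7 * n%:R :> R ->
  is_vertex (truncated_simplex
      (conv_hull (hadamard_vector (paley12 R : 'M_12) mark)) m n)
    (paley_vertex m%:R n%:R).
Proof.
move=> nm m_le; have hadP := paley12_hadamard R.
have m_gt0 : 0 < m%:R :> R by rewrite ltr0n (leq_ltn_trans _ nm).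
have nmR : n%:R < m%:R :> R by rewrite ltr_nat.
have n_ge0 : 0 <= n%:R :> R by rewrite ler0n.
pose f (t : 'I_6 + 'I_5) : 'rV[R]_(6 + 5) := match t with
  | inl i => - hadamard_vector (paley12 R : 'M_12) mark (lshift 6 i)
  | inr k => delta_mx 0 (rshift 6 k) end.
have f_row i t (y : 'rV_11) : \sum_k f (inl i) 0 k * y 0 k =
    t - slack (paley12 R : 'M_12) mark t y (lshift 6 i).
  rewrite slackE // opprD addrA subrr add0r -sumrN.
  by apply: eq_bigr => k _; rewrite mxE mulNr.
have f_coord k (y : 'rV_(6 + 5)) :
    \sum_l f (inr k) 0 l * y 0 l = y 0 (rshift 6 k).
  rewrite (bigD1 (rshift 6 k)) //= big1 => [|l /negPf lk].
    by rewrite mxE !eqxx mul1r addr0.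
  by rewrite mxE lk andbF mul0r.
have vert_coord k : paley_vertex m%:R n%:R 0 (rshift 6 k) = n%:R :> R.
  by rewrite row_mxEr mxE.
apply: (vertex_of_tight (f := f)).
- split.
    apply/dilated_simplexP => // i; case: (@split_ordP 6 6 i) => i' ->.
      by rewrite slack_vertex_top.
    by apply: slack_vertex_bottom; lra.
  move=> k; case: (@split_ordP 6 5 k) => k' ->.
    rewrite [X in _ <= X <= _](row_mxEl _ _ _ _).
    case: (@split_ordP 1 5 k') => k'' ->.
      by rewrite [X in _ <= X <= _](row_mxEl _ _ _ _) mxE ord1 eqxx mulr1n; lra.
    by rewrite [X in _ <= X <= _](row_mxEr _ _ _ _) mxE; lra.
  by rewrite vert_coord; lra.
- case=> [i|k] y [/(dilated_simplexP mark hadP y m_gt0) sl_y cube_y].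
    by rewrite !(f_row _ m%:R) slack_vertex_top subr0 lerBlDr lerDl.
  by rewrite !f_coord vert_coord; have /andP[] := cube_y (rshift 6 k).
move=> u fu0; have u_row : u = row_mx (lsubmx (u : 'rV_(6 + 5))) 0 :> 'rV_(6 + 5).
  rewrite -[LHS](@hsubmxK _ 1 6 5); congr row_mx.
  by apply/rowP => k; rewrite mxE -f_coord fu0 mxE.
rewrite u_row (_ : lsubmx _ = 0) ?row_mx0 //.
apply: slack_top_inj => i; rewrite -u_row.
by apply/eqP; rewrite -oppr_eq0 -sub0r -f_row fu0.
Qed.

Theorem proposition2p1 (R : realType) :
  exists Delta : set 'rV[R]_11,
    [/\ is_hadamard_simplex Delta,
        forall m n : nat, odd m -> odd n ->
          (n < m)%N -> m%:R < 7 * n%:R / 3 :> R ->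
          (m - n = 2 %[mod 4])%N ->
          nonintegral (truncated_simplex Delta m n) n
      & nonintegral (truncated_simplex Delta 5 3) 3].
Proof.
exists (conv_hull (hadamard_vector (paley12 R : 'M_12) mark)).
have nonint (m n : nat) : (n < m)%N -> m%:R < 7 * n%:R / 3 :> R ->
    (m - n = 2 %[mod 4])%N ->
    nonintegral (truncated_simplex
      (conv_hull (hadamard_vector (paley12 R : 'M_12) mark)) m n) n.
  move=> nm m_lt mn4; exists (paley_vertex m%:R n%:R); split.
    by apply: paley_vertexP => //; lra.
  (* If (5 n - 3 m) / 2 = n + 2 z, then 3 (n - m) = 4 z, against
     m - n = 2 mod 4. *)
  move=> /(_ (lshift 5 (lshift 5 (ord0 : 'I_1)) : 'I_11)) [z].
  rewrite [X in X = _](row_mxEl _ _ _ _) [X in X = _](row_mxEl _ _ _ _) mxE.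
  rewrite eqxx mulr1n => zE.
  have : (3 * n%:Z - 3 * m%:Z)%:~R = (4 * z)%:~R :> R.
    by rewrite rmorphB !rmorphM /=; lra.
  by move/intr_inj; lia.
split.
- exists (paley12 R : 'M_12), mark; split=> //; exact: paley12_hadamard.
- by move=> m n _ _; exact: nonint.
- by apply: nonint => //; lra.
Qed.
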